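(* A connected graph $G$ is proportionally $(2,3)$-choosable if and only if $G = P_n$ for some $n \in \mathbb{N}$.
   Context: All graphs are nonempty, finite and simple. $P_n$ denotes the path on $n$ vertices ($n\in\mathbb{N}=\{1,2,3,\ldots\}$); equality $G=P_n$ means $G$ is isomorphic to $P_n$. For $m\in\mathbb{N}$, $[m]=\{1,\ldots,m\}$. For integers $1\le k\le \ell$, a $(k,\ell)$-assignment for a graph $G$ is a function $L$ assigning to each vertex $v$ of $G$ a set $L(v)\subseteq[\ell]$ with $|L(v)|=k$. Let $\mathcal{L}=\bigcup_{v\in V(G)}L(v)$ and, for $c\in\mathcal{L}$, let $\eta(c)=|\{v\in V(G): c\in L(v)\}|$. A proportional $L$-coloring of $G$ is a function $f$ on $V(G)$ with $f(v)\in L(v)$ for every $v$, with $f(u)\ne f(v)$ whenever $u,v$ are adjacent, and with $|f^{-1}(c)|\in\{\lfloor \eta(c)/k\rfloor,\lceil \eta(c)/k\rceil\}$ for every $c\in\mathcal{L}$. $G$ is proportionally $(k,\ell)$-choosable if a proportional $L$-coloring of $G$ exists for every $(k,\ell)$-assignment $L$ for $G$. *)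

(* Defs.v *)
From mathcomp Require Export all_boot.

Set Implicit Arguments.
Unset Strict Implicit.
Unset Printing Implicit Defensive.

(* A simple graph is a symmetric irreflexive relation
   e : rel T on a finType T; these two conditions and the nonemptiness of T
   are hypotheses of the statements, not part of the definitions. *)

Definition connected_graph (T : finType) (e : rel T) : Prop :=
  forall x y : T, connect e x y.

Definition graph_iso (T1 T2 : finType) (e1 : rel T1) (e2 : rel T2) : Prop :=
  exists2 f : T1 -> T2, bijective f & forall x y, e2 (f x) (f y) = e1 x y.

Definition path_graph (n : nat) : rel 'I_n :=
  fun i j => (i.+1 == j :> nat) || (j.+1 == i :> nat).

Definition ceil_divn (m d : nat) : nat := m %/ d + ~~ (d %| m).

(* The color set {1, ..., l} is represented by 'I_l = {0, ..., l - 1}. *)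
Definition is_assignment (k l : nat) (T : finType) (L : T -> {set 'I_l}) :
    Prop :=
  forall v, #|L v| = k.

Definition palette (l : nat) (T : finType) (L : T -> {set 'I_l}) :
    {set 'I_l} :=
  \bigcup_(v : T) L v.

Definition multiplicity (l : nat) (T : finType) (L : T -> {set 'I_l})
    (c : 'I_l) : nat :=
  #|[set v : T | c \in L v]|.

Definition proportional_coloring (k l : nat) (T : finType) (e : rel T)
    (L : T -> {set 'I_l}) (f : T -> 'I_l) : Prop :=
  [/\ forall v, f v \in L v,
      forall u v, e u v -> f u <> f v
    & forall c, c \in palette L ->
        #|[set v : T | f v == c]| = multiplicity L c %/ k \/
        #|[set v : T | f v == c]| = ceil_divn (multiplicity L c) k].

(* Only meaningful for 1 <= k <= l. *)
Definition proportionally_choosable (k l : nat) (T : finType) (e : rel T) :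
    Prop :=
  forall L : T -> {set 'I_l}, is_assignment k L ->
    exists f : T -> 'I_l, proportional_coloring k e L f.

(* Main.v *)
(* Necessity: put the list {0, 1} on a vertex set A and {0, 2} elsewhere, so that
   color 1 is used on exactly half of A when #|A| is even. If A is a claw, color 1
   is used once or three times, so the maximum degree is at most 2, and a longest
   path of a connected graph then covers it: the graph is a path or a cycle. An
   odd cycle is not 2-colorable. On an even cycle take for A all vertices but two
   at distance 2: exactly one of these two gets color 2, which forces color 1 on
   all n/2 vertices at odd positions, one too many.

   Sufficiency: encode the lists by the word of missing colors; one extra letter
   makes all multiplicities even, so that each color has to be used on exactly
   half of the vertices whose list contains it. In a shortest unsolvable word, no
   removable factor occurs: two equal letters tt, a factor abc followed by a, or,
   next to a letter c (or to an end of the word), a factor (ab)^2m or (ab)^(2m+1)c.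
   Hence its length is odd and some letter b occupies exactly every other position,
   the end positions included. Such a word is colored along one of the two
   derangements of the colors inside a suitable window of just over half of the
   word and along the other one outside. *)
Require Import Defs.
From mathcomp Require Import zify.

Set Implicit Arguments.
Unset Strict Implicit.
Unset Printing Implicit Defensive.

(** * Words of missing colors *)

Lemma color3 (a b c x : 'I_3) :
  a != b -> b != c -> a != c -> [\/ x = a, x = b | x = c].
Proof.
move: a b c x => [[|[|[|//]]] ia] [[|[|[|//]]] ib] [[|[|[|//]]] ic] [[|[|[|//]]] ix];
  rewrite -!val_eqE //= => _ _ _;
  by [constructor 1; apply: val_inj | constructor 2; apply: val_inj | constructor 3; apply: val_inj].
Qed.

Lemma third_color (a b : 'I_3) : a != b -> exists c : 'I_3, (b != c) && (a != c).
Proof.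
move: a b => [[|[|[|//]]] ia] [[|[|[|//]]] ib] //= _;
by [exists (inord 0); rewrite -!val_eqE /= inordK | exists (inord 1); rewrite -!val_eqE /= inordK
  | exists (inord 2); rewrite -!val_eqE /= inordK].
Qed.

Definition neq : rel 'I_3 := fun x y => x != y.

(* [w] lists the missing colors: the multiplicity of [x] is [count (predC1 x) w]. *)
Definition balanced (w f : seq 'I_3) :=
  forall x, (count_mem x f).*2 = count (predC1 x) w.

Definition solvable (w : seq 'I_3) :=
  exists f, [/\ all2 neq w f, sorted neq f & balanced w f].

Definition even_word (w : seq 'I_3) := forall x, ~~ odd (count (predC1 x) w).

Definition junction (f g : seq 'I_3) :=
  if f is x :: f' then if g is y :: _ then last x f' != y else true else true.

Lemma sorted_junction f g :
  sorted neq (f ++ g) = [&& sorted neq f, sorted neq g & junction f g].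
Proof.
case: f => [|x f] /=; first by rewrite andbT.
rewrite cat_path; case: g => [|y g] /=; first by rewrite andbT.
by rewrite [in RHS]andbC [in RHS]andbC /neq; congr (_ && _); rewrite andbC.
Qed.

Lemma all2_size (w f : seq 'I_3) : all2 neq w f -> size f = size w.
Proof. by rewrite all2E => /andP[/eqP]. Qed.

Lemma all2_cat (w1 w2 f1 f2 : seq 'I_3) : size f1 = size w1 ->
  all2 neq (w1 ++ w2) (f1 ++ f2) = all2 neq w1 f1 && all2 neq w2 f2.
Proof.
elim: w1 f1 => [|x w1 IH] [|y f1] //= [sz].
by rewrite IH // andbA.
Qed.

Lemma all2_split (w1 w2 f : seq 'I_3) : all2 neq (w1 ++ w2) f ->
  exists f1 f2, [/\ f = f1 ++ f2, all2 neq w1 f1 & all2 neq w2 f2].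
Proof.
elim: w1 f => [|x w1 IH] f /=; first by exists [::], f.
case: f => [//|y f] /andP[xy /IH[f1 [f2 [-> h1 h2]]]].
by exists (y :: f1), f2; rewrite /= xy.
Qed.

(** The equation [last c u = c] says that [u] is empty or ends with [c]. In the latter case [c] is
    missing from the last list, so [f] cannot end with it. *)
Lemma all2_last (u f f' : seq 'I_3) (c : 'I_3) :
  all2 neq u f -> last c u = c -> junction f (c :: f').
Proof.
case/lastP: u => [|u z]; first by case: f.
rewrite last_rcons => h zc; subst z; case/lastP: f h => [//|f y] h.
have := all2_size h; rewrite !size_rcons => -[sz].
move: h; rewrite -!cats1 all2_cat //= andbT => /andP[_ cy].
by rewrite cats1; case: f {sz} => [|z f] /=; rewrite ?last_rcons eq_sym.
Qed.

Lemma all2_head (v f : seq 'I_3) (x : 'I_3) f' :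
  all2 neq v f -> head (last x f') v = last x f' -> junction (x :: f') f.
Proof. by case: v f => [|z v] [|y f] //= /andP[zy _] <-. Qed.

(** * Removable factors of a word *)

Lemma balanced_insert u W v fu g fv : balanced W g ->
  balanced (u ++ v) (fu ++ fv) -> balanced (u ++ W ++ v) (fu ++ g ++ fv).
Proof.
move=> bg bal x; have := bal x.
by rewrite !count_cat !doubleD (bg x) addnCA => ->; rewrite addnCA.
Qed.

(* The type of the letter next to [W] already excludes a conflict with the
   adjacent end of the coloring of [W]. *)
Lemma free_block u W v x g :
  all2 neq W (x :: g) -> path neq x g -> balanced W (x :: g) ->
  last x u = x -> head (last x g) v = last x g ->
  solvable (u ++ v) -> solvable (u ++ W ++ v).
Proof.
move=> Wg pg bg hu hv [f [/all2_split[fu [fv [-> cu cv]]] srt bal]].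
exists (fu ++ (x :: g) ++ fv); split.
- by rewrite !all2_cat ?(all2_size cu) ?(all2_size Wg) // cu Wg.
- move: srt; rewrite !sorted_junction (all2_head cv hv) => /and3P[-> -> _].
  by rewrite [sorted neq (x :: g)]pg (all2_last (g ++ fv) cu hu).
- exact: balanced_insert.
Qed.

Lemma even_remove u W v f : balanced W f -> even_word (u ++ W ++ v) ->
  even_word (u ++ v).
Proof.
move=> bal ev x; have := ev x; have := bal x; rewrite !count_cat; lia.
Qed.

Definition alt (a b : 'I_3) m := flatten (nseq m [:: a; b]).

Arguments alt : simpl never.

Lemma altD a b m n : alt a b (m + n) = alt a b m ++ alt a b n.
Proof. by rewrite /alt nseqD flatten_cat. Qed.

Lemma altS a b m : alt a b m.+1 = alt a b m ++ [:: a; b].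
Proof. by rewrite -[m.+1]addn1 altD. Qed.

Lemma size_alt a b m : size (alt a b m) = m.*2.
Proof. by elim: m => // m IH; rewrite altS size_cat IH addn2. Qed.

Lemma count_alt P a b m : count P (alt a b m) = m * (P a + P b).
Proof. by elim: m => // m IH; rewrite altS count_cat IH /= addn0 mulSnr. Qed.

Lemma last_alt x a b m : last x (alt a b m) = if m is 0 then x else b.
Proof. by case: m => // m; rewrite altS last_cat. Qed.

Lemma path_alt x a b m : a != b -> x != a -> path neq x (alt a b m).
Proof.
elim: m x => //= m IH x ab xa.
by rewrite /neq xa ab IH // eq_sym.
Qed.

Lemma all2_alt a b x y m : a != x -> b != y -> all2 neq (alt a b m) (alt x y m).
Proof. by move=> ax b_y; elim: m => //= m ->; rewrite /neq ax b_y. Qed.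

Section Distinct.
Variables (a b c : 'I_3).
Hypotheses (ab : a != b) (bc : b != c) (ac : a != c).

Let ba : b != a. Proof. by rewrite eq_sym. Qed.
Let cb : c != b. Proof. by rewrite eq_sym. Qed.
Let ca : c != a. Proof. by rewrite eq_sym. Qed.

(** For [m > 0] the block is colored [(ca)^m (bc)^m], which begins and ends with [c]; hence the
    condition on the letters on both sides. *)
Lemma alt_even_block u m v : last c u = c -> head c v = c ->
  solvable (u ++ v) -> solvable (u ++ alt a b m.*2 ++ v).
Proof.
case: m => // m hu hv.
have E : alt c a m.+1 ++ alt b c m.+1 = c :: (a :: alt c a m ++ alt b c m.+1).
  by [].
apply: (@free_block _ (alt a b m.+1.*2) _ c (a :: alt c a m ++ alt b c m.+1)) => //; rewrite -?E.
- by rewrite -addnn altD all2_cat ?size_alt // !all2_alt.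
- suff /path_sorted: path neq b (alt c a m.+1 ++ alt b c m.+1) by [].
  by rewrite cat_path last_alt !path_alt.
- move=> x; rewrite count_cat !count_alt /=.
  case: (color3 x ab bc ac) => ->;
  rewrite ?eqxx ?(negPf ab) ?(negPf bc) ?(negPf ac) ?(negPf ba) ?(negPf cb) ?(negPf ca) /=; lia.
- by rewrite /= last_cat last_alt hv.
Qed.

Lemma alt_odd_balanced m :
  balanced (alt a b m.*2.+1 ++ [:: c]) (alt c a m.+1 ++ alt b c m ++ [:: b]).
Proof.
have [n En] : {n | n = m.*2} by exists m.*2.
move=> x; rewrite -En !count_cat !count_alt /=.
case: (color3 x ab bc ac) => ->;
rewrite ?eqxx ?(negPf ab) ?(negPf bc) ?(negPf ac) ?(negPf ba) ?(negPf cb) ?(negPf ca) /=; lia.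
Qed.

(** The coloring [(ca)^(m+1) (bc)^m b] begins with [c] but ends with [b], so the letter on the right
    has to be [b]. *)
Lemma alt_odd_block u m v : last c u = c -> head b v = b ->
  solvable (u ++ v) -> solvable (u ++ (alt a b m.*2.+1 ++ [:: c]) ++ v).
Proof.
move=> hu hv.
have E : alt c a m.+1 ++ alt b c m ++ [:: b] = c :: (a :: alt c a m ++ alt b c m ++ [:: b]).
  by [].
apply: (@free_block _ (alt a b m.*2.+1 ++ [:: c]) _ c (a :: alt c a m ++ alt b c m ++ [:: b])) => //; rewrite -?E.
- rewrite -addnn -addSn altD -catA !all2_cat ?size_alt // !all2_alt //=.
  by rewrite /neq ac ba cb.
- suff /path_sorted: path neq b (alt c a m.+1 ++ alt b c m ++ [:: b]) by [].
  by rewrite !cat_path !last_alt !path_alt //=; case: (m) => [|n]; rewrite /neq bc ca ?ab ?cb.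
- exact: alt_odd_balanced.
- by rewrite /= !last_cat hv.
Qed.

Lemma balanced_abc (f : seq 'I_3) : perm_eq f [:: a; b; c] -> balanced [:: a; b; c] f.
Proof.
move=> /permP pf x; rewrite pf /=.
case: (color3 x ab bc ac) => ->;
by rewrite ?eqxx ?(negPf ab) ?(negPf bc) ?(negPf ac) ?(negPf ba) ?(negPf cb) ?(negPf ca).
Qed.

(** The letter [a] after the block keeps the color there different from [a], so [b c a] fits unless
    the coloring on the left ends with [b]. In that case [c a b] fits: the old coloring already had
    this [b] next to the color that now follows the block. *)
Lemma triple_block u v :
  solvable (u ++ a :: v) -> solvable (u ++ [:: a; b; c] ++ a :: v).
Proof.
move=> [f [/all2_split[fu [fv [-> cu cv]]] srt bal]].
suff [g [cg sg bg jg]] : exists g, [/\ all2 neq [:: a; b; c] g, sorted neq g,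
    perm_eq g [:: a; b; c] & junction fu (g ++ fv) && junction g fv].
  exists (fu ++ g ++ fv); split.
  - by rewrite !all2_cat ?(all2_size cu) ?(all2_size cg) // cu cg.
  - move: srt jg; rewrite !sorted_junction => /and3P[-> -> _] /andP[-> ->].
    by rewrite sg.
  - exact: balanced_insert (balanced_abc bg) bal.
have ha : head b fv != a by case: fv cv {srt bal} => //= y fv /andP[]; rewrite /neq eq_sym.
move: srt; rewrite sorted_junction => /and3P[_ _ jf].
have [jb|nb] := boolP (junction fu [:: b]).
  exists [:: b; c; a]; rewrite /= /neq ?ab ?bc ?ca; split=> //.
    by rewrite (perm_catC [:: b; c] [:: a]).
  by case: fu jb {cu bal jf} => [_|x fu /= ->]; case: fv ha {cv} => //= y fv; rewrite eq_sym.
exists [:: c; a; b]; rewrite /= /neq ?ac ?ba ?cb ?ca ?ab; split=> //.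
- by rewrite (perm_catC [:: c] [:: a; b]).
case: fu jf nb {cu bal} => [//|x fu] /= jf; rewrite negbK => /eqP lb.
by move: jf; rewrite lb bc; case: fv {ha cv}.
Qed.

(** * Words in which [b] fills every other position *)

Lemma all_ac_count w P (g : 'I_3 -> seq 'I_3) : all (predC1 b) w ->
  count P (flatten (map g w)) =
    count_mem a w * count P (g a) + count_mem c w * count P (g c).
Proof.
elim: w => //= x w IH /andP[xb /IH{}IH]; rewrite count_cat IH.
case: (color3 x ab bc ac) xb => ->; rewrite ?eqxx ?(negPf ac) ?(negPf ca) //=; lia.
Qed.

(* The derangements b -> a -> c -> b and b -> c -> a -> b, on a pair [n b]. *)
Let minus n := if n == a then [:: c; a] else [:: b; a].
Let plus n := if n == a then [:: b; c] else [:: a; c].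

Lemma window_solvable w1 w2 w3 : let ws := w1 ++ w2 ++ w3 in
  all (predC1 b) ws -> head a w2 = a -> head c w3 = c ->
  (count_mem a w2).*2 = (count_mem a ws).+1 ->
  (count_mem c w2).*2 = (count_mem c ws).+1 ->
  solvable (b :: flatten [seq [:: n; b] | n <- ws]).
Proof.
move=> ws wb h2 h3 na nc.
have [wb1 wb2 wb3] : [/\ all (predC1 b) w1, all (predC1 b) w2 & all (predC1 b) w3].
  by move: wb; rewrite !all_cat => /and3P.
have pm w : all (predC1 b) w -> path neq a (flatten (map minus w)) && (last a (flatten (map minus w)) == a).
  elim: w => //= x w IH /andP[xb /IH{IH}/andP[IH1 IH2]].
  by rewrite /minus; case: ifP => _; rewrite /= IH1 IH2 /neq ?ab ?ac ?ba ?ca.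
have pp w : all (predC1 b) w -> path neq c (flatten (map plus w)) && (last c (flatten (map plus w)) == c).
  elim: w => //= x w IH /andP[xb /IH{IH}/andP[IH1 IH2]].
  by rewrite /plus; case: ifP => _; rewrite /= IH1 IH2 /neq ?ac ?bc ?cb ?ca.
have am w : all (predC1 b) w -> all2 neq (flatten [seq [:: n; b] | n <- w]) (flatten (map minus w)).
  elim: w => //= x w IH /andP[xb /IH{}IH].
  by rewrite /minus; case: ifP => [/eqP->|_]; rewrite /= IH /neq ?ac ?ba ?xb.
have ap w : all (predC1 b) w -> all2 neq (flatten [seq [:: n; b] | n <- w]) (flatten (map plus w)).
  elim: w => //= x w IH /andP[xb /IH{}IH].
  by rewrite /plus; case: ifP => [/eqP->|/negbT xa]; rewrite /= IH /neq ?ab ?bc ?xa.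
exists (a :: flatten (map minus w1) ++ flatten (map plus w2) ++ flatten (map minus w3)); split.
- rewrite /= {1}/neq ba !map_cat !flatten_cat !all2_cat ?am ?ap //.
    exact: all2_size (ap _ wb2).
  exact: all2_size (am _ wb1).
(* By [na] the window is nonempty, so its head is a genuine letter and not the default. *)
- have [w E] : exists w, w2 = a :: w.
    by case: (w2) h2 na => [|x w] //= ->; exists w.
  move: wb2; rewrite /= !cat_path E => /andP[_ wb2].
  have /andP[-> /eqP->] := pm _ wb1.
  rewrite /= /plus eqxx /= -/plus.
  have /andP[-> /eqP->] := pp _ wb2; rewrite /neq ab bc /=.
  case: (w3) h3 wb3 => [//|y w'] /= -> /andP[_ wb3].
  by rewrite /minus (negPf ca) /=; have /andP[-> _] := pm _ wb3; rewrite /neq ba cb.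
- move=> x; rewrite -[flatten (map _ ws)]/(flatten (map (fun n => [:: n; b]) ws)) /=.
  rewrite !count_cat !all_ac_count //.
  move: na nc; rewrite /ws !count_cat /minus /plus eqxx (negPf ca) /=.
  move: (count_mem a w1) (count_mem a w2) (count_mem a w3).
  move: (count_mem c w1) (count_mem c w2) (count_mem c w3).
  clear -ab bc ac ba cb ca => p1 p2 p3 n1 n2 n3.
  case: (color3 x ab bc ac) => ->;
  rewrite ?eqxx ?(negPf ab) ?(negPf bc) ?(negPf ac) ?(negPf ba) ?(negPf cb) ?(negPf ca) /=; lia.
Qed.
End Distinct.

Lemma other_colors (t : 'I_3) : exists p q, [/\ t != p, p != q & t != q].
Proof.
have [p tp] : exists p, t != p.
  exists (if t == ord0 then ord_max else ord0).
  by case: ifP => [/eqP->|/negbT].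
by have [q /andP[pq tq]] := third_color tp; exists p, q.
Qed.

(** The block takes the two colors other than [t]. The colors on its two sides differ, having been
    adjacent before, so at least one of the two orders fits. *)
Lemma pair_block u t v : solvable (u ++ v) -> solvable (u ++ [:: t; t] ++ v).
Proof.
move=> [f [/all2_split[fu [fv [-> cu cv]]] srt bal]].
have [p [q [tp pq tq]]] := other_colors t.
have qp : q != p by rewrite eq_sym.
suff [g [cg sg bg jg]] : exists g, [/\ all2 neq [:: t; t] g, sorted neq g,
    perm_eq g [:: p; q] & junction fu (g ++ fv) && junction g fv].
  exists (fu ++ g ++ fv); split.
  - by rewrite !all2_cat ?(all2_size cu) ?(all2_size cg) // cu cg.
  - move: srt jg; rewrite !sorted_junction => /and3P[-> -> _] /andP[-> ->].
    by rewrite sg.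
  - apply: balanced_insert bal => x; move/permP: bg => -> /=.
    case: (color3 x tp pq tq) => ->; rewrite ?eqxx
      ?(negPf tp) ?(negPf pq) ?(negPf tq) ?(negPf qp) ?[_ == t]eq_sym
      ?(negPf tp) ?(negPf tq) //=.
move: srt; rewrite sorted_junction => /and3P[_ _ jf].
have [/andP[jl jr]|nj] := boolP (junction fu [:: p] && junction [:: q] fv).
  exists [:: p; q]; rewrite /= /neq tp tq pq; split=> //.
  by apply/andP; split=> //; case: (fu) jl.
exists [:: q; p]; rewrite /= /neq tp tq qp; split=> //.
  by rewrite (perm_catC [:: q] [:: p]).
case: fu fv jf nj {cu cv bal} => [|x fu] [|y fv] //=; rewrite ?andbT.
- by rewrite negbK => _ /eqP <-.
- by rewrite negbK => _ /eqP ->.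
- rewrite negb_and !negbK => jf /orP[]/eqP E; first by move: jf; rewrite E pq.
  by rewrite -E pq E jf.
Qed.

(** * Choice of the window *)

Lemma discrete_ivt (F : nat -> nat) m g :
    (forall k, k < m -> F k.+1 <= (F k).+1 /\ F k <= (F k.+1).+1) ->
    (F 0 <= g <= F m) || (F m <= g <= F 0) ->
  exists2 k, k <= m & F k = g.
Proof.
elim: m => [|m IH] step h; first by exists 0 => //; lia.
have [Fm|Fm] := eqVneq (F m.+1) g; first by exists m.+1.
have [||k km Fk] := IH; last by exists k => //; apply: leqW.
  by move=> k km; apply: step; apply: ltnW.
have := step m (ltnSn m); lia.
Qed.

(* Window counts change by at most one per shift, so some window of [h.+2]
   letters holds the right number of [a]'s; if the letter after the rightmost
   such window were equal to its first letter, it could be shifted once more. *)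
Lemma window_exists (a : 'I_3) ws h : size ws = h.+1.*2 -> odd (count_mem a ws) ->
  exists w1 w2 w3, [/\ ws = w1 ++ w2 ++ w3, size w2 = h.+2,
    (count_mem a w2).*2 = (count_mem a ws).+1 &
    w3 = [::] \/ head a w2 <> head a w3].
Proof.
move=> sz oddA; set A := count_mem a ws in oddA *.
pose F k := count_mem a (take h.+2 (drop k ws)).
have rec k : k < h -> F k + (nth a ws (k + h.+2) == a) = F k.+1 + (nth a ws k == a).
  move=> kh; have E : drop k ws = nth a ws k :: drop k.+1 ws.
    by apply: drop_nth; lia.
  have lt : h.+2 < size (drop k ws) by rewrite size_drop; lia.
  have := congr1 (count_mem a) (take_nth a lt).
  rewrite -cats1 count_cat nth_drop {1}E [take h.+3 _]/= /= /F addn0 => <-.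
  exact: addnC.
have F0 : F 0 = count_mem a (take h.+2 ws) by rewrite /F drop0.
have Fh : F h = count_mem a (drop h ws).
  by rewrite /F take_oversize // size_drop; lia.
have cA : F 0 + count_mem a (drop h.+2 ws) = A by rewrite F0 -count_cat cat_take_drop.
(* The first and the last window cover the word and overlap in two letters, so [F 0 + F h] lies
   between [A] and [A + 2]. As [A] is odd, [A.+1./2] lies between [F 0] and [F h]. *)
have cB : F h = count_mem a (take 2 (drop h ws)) + count_mem a (drop h.+2 ws).
  by rewrite Fh -{1}(cat_take_drop 2 (drop h ws)) count_cat drop_drop add2n.
have le2 : count_mem a (take 2 (drop h ws)) <= 2.
  apply: leq_trans (count_size _ _) _; rewrite size_take; case: ifP; lia.
pose good k := (k <= h) && (F k == A.+1./2).
have ex : exists k, good k.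
  have [i ih||i ih Fi] := @discrete_ivt F h A.+1./2.
  - have := rec i ih; lia.
  - lia.
  by exists i; rewrite /good ih Fi eqxx.
have bnd k : good k -> k <= h by case/andP.
case: (ex_maxnP ex bnd) => k /andP[kh /eqP Fk] kmax.
exists (take k ws), (take h.+2 (drop k ws)), (drop h.+2 (drop k ws)).
rewrite !cat_take_drop size_take size_drop -/(F k) Fk; split=> //.
- case: ifP; lia.
- lia.
have [->|kh'] := eqVneq k h.
  by left; rewrite drop_drop; apply: drop_oversize; lia.
right=> E; have lt : k < h by lia.
have lt1 : k < size ws by rewrite sz; lia.
have lt2 : h.+2 + k < size ws by rewrite sz; lia.
have := kmax k.+1; rewrite /good lt => /(_ _) contra.
suff : k.+1 <= k by lia.
apply: contra; rewrite -Fk; have := rec k lt.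
move: E; rewrite drop_drop (drop_nth a lt1) (drop_nth a lt2) /=.
rewrite addnC => ->; lia.
Qed.

Lemma count_distinct (a b c : 'I_3) ws : a != b -> b != c -> a != c ->
  all (predC1 b) ws -> count_mem a ws + count_mem c ws = size ws.
Proof.
move=> ab bc ac; elim: ws => //= x w IH /andP[xb /IH].
case: (color3 x ab bc ac) xb => ->; rewrite ?eqxx // ?(negPf ac) ?[c == a]eq_sym ?(negPf ac); lia.
Qed.

(** Evenness makes both [a] and [c] occur an odd number of times in [ws]. A window of one letter
    more than half of [ws] that contains half of the [a], rounded up, then also contains half of the
    [c], rounded up. *)
Lemma alternating_solvable (a b c : 'I_3) ws : a != b -> b != c -> a != c ->
    all (predC1 b) ws -> even_word (b :: flatten [seq [:: n; b] | n <- ws]) ->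
  solvable (b :: flatten [seq [:: n; b] | n <- ws]).
Proof.
move=> ab bc ac wb ev; have sz := count_distinct ab bc ac wb.
have ba : b != a by rewrite eq_sym.
have cb : c != b by rewrite eq_sym.
have ca : c != a by rewrite eq_sym.
have [oA oC] : odd (count_mem a ws) /\ odd (count_mem c ws).
  have := ev a; have := ev b; have := ev c; rewrite /= !(all_ac_count ab bc ac _ _ wb) /=.
  move: (count_mem a ws) (count_mem c ws) sz; clear -ab bc ac ba cb ca => p q _.
  rewrite ?eqxx ?(negPf ab) ?(negPf bc) ?(negPf ac) ?(negPf ba) ?(negPf cb) ?(negPf ca) /=; lia.
have [h hs] : exists h, size ws = h.+1.*2.
  by exists (size ws)./2.-1; move: oA oC; rewrite -sz; clear; lia.
have [w1 [w2 [w3 [E s2 na nx]]]] := window_exists hs oA.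
have nc : (count_mem c w2).*2 = (count_mem c ws).+1.
  have wb2 : all (predC1 b) w2 by move: wb; rewrite E !all_cat => /and3P[].
  move: (count_distinct ab bc ac wb2) na hs; rewrite s2 -sz; clear; lia.
have hd (w : seq 'I_3) : all (predC1 b) w -> 0 < size w -> head a w = a \/ head a w = c.
  case: w => //= x w /andP[xb _] _.
  by case: (color3 x ab bc ac) xb => ->; rewrite ?eqxx; auto.
move: wb na nc; rewrite E => wb na nc.
have /and3P[_ wb2 wb3] : [&& all (predC1 b) w1, all (predC1 b) w2 & all (predC1 b) w3].
  by rewrite -!all_cat.
case: (hd w2 wb2) => [|h2|h2]; first by rewrite s2.
  apply: (window_solvable ab bc ac) => //.
  case: w3 {E wb na nc} wb3 nx => [//|y w3] wb3 [//|]; rewrite h2 => nx.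
  by case: (hd _ wb3 isT) => // E; case: nx.
(* A window that begins with [c] is treated with [a] and [c] exchanged. *)
apply: (window_solvable cb ba ca) => //.
  by case: w2 {E wb na nc wb2 nx} s2 h2.
case: w3 {E wb na nc} wb3 nx => [//|y w3] wb3 [//|]; rewrite h2 => nx.
by case: (hd _ wb3 isT) => // E; case: nx.
Qed.

(** * Scan of an even word all of whose shorter even words are solvable *)

Definition alternating b (v : seq 'I_3) :=
  forall i, i < size v -> (nth b v i == b) = ~~ odd i.

Section Scan.
Variable w : seq 'I_3.
Hypothesis ev : even_word w.
Hypothesis IH : forall w', size w' < size w -> even_word w' -> solvable w'.

Lemma pair_case u t v : w = u ++ [:: t; t] ++ v -> solvable w.
Proof.
move=> E; rewrite E; apply: pair_block; apply: IH.
  by rewrite E !size_cat /=; lia.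
by move=> x; have := ev x; rewrite E !count_cat /=; lia.
Qed.

Lemma triple_case a b c u v : a != b -> b != c -> a != c ->
  w = u ++ [:: a; b; c] ++ a :: v -> solvable w.
Proof.
move=> ab bc ac E; rewrite E; apply: (triple_block ab bc ac); apply: IH.
  by rewrite E !size_cat /=; lia.
apply: (@even_remove _ [:: a; b; c] _ [:: a; b; c]); last by rewrite -E.
exact: balanced_abc.
Qed.

Lemma alt_even_case a b c u m v : a != b -> b != c -> a != c -> 0 < m ->
  w = u ++ alt a b m.*2 ++ v -> last c u = c -> head c v = c -> solvable w.
Proof.
move=> ab bc ac m0 E hu hv; rewrite E; apply: (alt_even_block ab bc ac) => //; apply: IH.
  by rewrite E !size_cat size_alt; lia.
by move=> x; have := ev x; rewrite E !count_cat count_alt; lia.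
Qed.

(** An even power is removable as it stands. For an odd power the letter after [c] decides: [b] or
    the end of the word gives the odd block, [a] gives [abc] followed by [a], and [c] gives a
    pair. *)
Lemma alt_case a b c u j v : a != b -> b != c -> a != c ->
  w = u ++ alt a b j.+1 ++ c :: v -> last c u = c -> solvable w.
Proof.
move=> ab bc ac E hu; case: (boolP (odd j.+1)) => oj; last first.
  have Ej : j.+1 = (j.+1)./2.*2 by lia.
  apply: (@alt_even_case a b c u (j.+1)./2 (c :: v)) => //; last by rewrite -Ej.
  lia.
have hv0 : head b v = b -> solvable w.
  have Ej : j.+1 = (j./2).*2.+1 by lia.
  move=> hv; have E' : w = u ++ (alt a b (j./2).*2.+1 ++ [:: c]) ++ v.
    by rewrite E -Ej -catA.
  rewrite E'; apply: (alt_odd_block ab bc ac) => //; apply: IH.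
    by rewrite E' !size_cat ltn_add2l -[X in X < _]add0n ltn_add2r addn1.
  by apply: even_remove (alt_odd_balanced ab bc ac j./2) _; rewrite -E'.
case: v E hv0 => [|y v] E hv0; first exact: hv0.
move: E hv0; case: (color3 y ab bc ac) => -> E hv0.
- apply: (@triple_case a b c (u ++ alt a b j) v) => //.
  by rewrite E altS -!catA.
- exact: hv0.
- by apply: (@pair_case (u ++ alt a b j.+1) c v); rewrite E -!catA.
Qed.

Lemma alternatingSS b e s v : alternating b v -> e = b -> s != b -> alternating b [:: e, s & v].
Proof.
move=> alt_v -> sb [|[|i]] //=; first by rewrite eqxx.
  by rewrite (negPf sb).
by rewrite !ltnS negbK => /alt_v.
Qed.

(* [u] ends with [z] or is empty: [alt b t j.+1] is a maximal alternating run to the left. *)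
Lemma scan n v u (b t z : 'I_3) j : size v <= n -> b != t -> t != z -> b != z ->
  w = u ++ alt b t j.+1 ++ v -> last z u = z -> solvable w \/ alternating b v.
Proof.
elim: n v u t z j => [|n IHn] [|e v] u t z j // sz bt tz bz E hu; try by right.
have zt : z != t by rewrite eq_sym.
case: (color3 e bt tz bz) E => -> E.
- case: v sz E => [|s v] sz E; first by right; case=> //= _; rewrite eqxx.
  have szv : size v <= n by move: sz; rewrite /=; lia.
  move: E; case: (color3 s bt tz bz) => -> E.
  + by left; apply: (@pair_case (u ++ alt b t j.+1) b v); rewrite E -!catA.
  + have E' : w = u ++ alt b t j.+2 ++ v by rewrite E (altS b t j.+1) -!catA.
    have [?|sv] := IHn v u t z j.+1 szv bt tz bz E' hu; [by left|right].
    by apply: alternatingSS; rewrite // eq_sym.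
  (* The old run stops here and [b z] opens a new one, preceded by [t]; so [t] and [z] change
     roles. *)
  + have E' : w = (u ++ alt b t j.+1) ++ alt b z 1 ++ v by rewrite E -!catA.
    have lt : last t (u ++ alt b t j.+1) = t by rewrite last_cat last_alt.
    have [?|sv] := IHn v _ z t 0 szv bz zt bt E' lt; [by left|right].
    by apply: alternatingSS; rewrite // eq_sym.
- left; apply: (@pair_case (u ++ alt b t j ++ [:: b]) t v).
  by rewrite E altS -!catA.
- by left; apply: (@alt_case b t z u j v).
Qed.

(** The first two letters are the initial run of the scan. A one-letter word is not even, since each
    of the other two colors has multiplicity one. *)
Lemma even_start : solvable w \/ w = [::] \/
  exists x y v, [/\ w = [:: x, y & v], x != y & alternating x w].
Proof.
case: w ev (@scan (size w)) (@pair_case [::]) => [|x [|y v]] evw sc pc.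
- by right; left.
- have [p [q [xp _ _]]] := other_colors x.
  by have := evw p; rewrite /= xp.
- have [xy|xy] := eqVneq x y; first by left; apply: (pc x v); rewrite xy.
  have [z /andP[yz xz]] := third_color xy.
  have [|?|sv] := sc v [::] x y z 0 _ xy yz xz erefl erefl; [by rewrite /=; lia|by left|].
  right; right; exists x, y, v; split=> //.
  by apply: alternatingSS; rewrite // eq_sym.
Qed.
End Scan.

(** * Solvability of all even words *)

Lemma solvable_rev w : solvable (rev w) -> solvable w.
Proof.
move=> [f [h1 h2 h3]]; exists (rev f); split.
- rewrite -(revK w); move: h1; rewrite !all2E !size_rev => /andP[/eqP sz h].
  by rewrite sz eqxx -rev_zip ?size_rev // all_rev.
- by rewrite rev_sorted (eq_sorted (e' := neq)) // => x y; rewrite /neq eq_sym.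
- by move=> x; have := h3 x; rewrite !count_rev.
Qed.

Lemma even_rev w : even_word w -> even_word (rev w).
Proof. by move=> ev x; rewrite count_rev. Qed.

Lemma alternating_shape b v : alternating b v -> odd (size v) ->
  exists2 ws, all (predC1 b) ws & v = b :: flatten [seq [:: n; b] | n <- ws].
Proof.
have [n] := ubnP (size v); elim: n v => // n IHn [|x [|y v]] //= sz av ov.
  by exists [::] => //; have := av 0 isT; rewrite /= => /eqP->.
have [|i iv||ws wsb E] := IHn v; first by move: sz; lia.
- by have := av i.+2; rewrite /= !ltnS negbK; apply.
- by rewrite negbK in ov.
exists (y :: ws); first by rewrite /= wsb andbT; have /= -> := av 1 isT.
by rewrite /= -E; have /= /eqP-> := av 0 isT.
Qed.

(** Even length exchanges the parities of a position counted from the left and from the right, so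
    [a] and [b] fill complementary positions. *)
Lemma alternating_both a b v : alternating a v -> alternating b (rev v) ->
  ~~ odd (size v) -> v = alt a b (size v)./2.
Proof.
move=> av bv ov; apply: (@eq_from_nth _ a); first by rewrite size_alt; lia.
move=> i iv; have nalt m k : k < m.*2 -> nth a (alt a b m) k = if odd k then b else a.
  by elim: m k => // m IH [|[|k]] //= km; rewrite negbK; apply: IH; lia.
rewrite nalt; last by lia.
case: ifP => oi; last by apply/eqP; rewrite av // oi.
have := bv (size v - i.+1); rewrite size_rev nth_rev; last by lia.
have -> : size v - (size v - i.+1).+1 = i by lia.
move=> bvi; have {bvi} : (nth b v i == b) = ~~ odd (size v - i.+1) by apply: bvi; lia.
have -> : odd (size v - i.+1) = false by lia.
by move/eqP => <-; apply: set_nth_default.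
Qed.

(** For odd length the scan leads to [alternating_solvable]. For even length a second scan, of the
    reversed word, leaves only [(xy)^m]; here [y] has multiplicity [m], so [m] is even and the whole
    word is a removable block. *)
Lemma even_solvable w : even_word w -> solvable w.
Proof.
have [n] := ubnP (size w); elim: n w => // n IHn w sz ev.
have IH w' : size w' < size w -> even_word w' -> solvable w'.
  by move=> sw; apply: IHn; lia.
have [//|[->|[x [y [v [E xy av]]]]]] := even_start ev IH.
  by exists [::]; split.
have [z /andP[yz xz]] := third_color xy.
have yx : y != x by rewrite eq_sym.
case: (boolP (odd (size w))) => ow.
  have [ws wsb Ew] := alternating_shape av ow; move: ev; rewrite Ew.
  exact: (alternating_solvable yx xz yz).
have IHr w' : size w' < size (rev w) -> even_word w' -> solvable w'.
  by rewrite size_rev; apply: IH.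
case: (even_start (even_rev ev) IHr) => [|[/(congr1 size)|[b [c [u [_ _ bw]]]]]].
- exact: solvable_rev.
- by rewrite size_rev E.
have Ew := alternating_both av bw ow.
have Eb : b = y.
  by move: Ew; rewrite {1}E; case: (size w)./2 => // m [].
subst b; set m := (size w)./2 in Ew.
have om : ~~ odd m.
  by have := ev y; rewrite Ew count_alt /= eqxx (negPf xy); lia.
apply: (@alt_even_case w ev IH x y z [::] m./2 [::]) => //.
  have : size w = (size v).+2 by rewrite E.
  rewrite /m; lia.
by rewrite cats0 Ew; congr alt; lia.
Qed.

(** * From even words to all words *)

Definition proportional (w f : seq 'I_3) :=
  [/\ all2 neq w f, sorted neq f &
   forall x, let k := count (predC1 x) w in
     count_mem x f = k./2 \/ count_mem x f = uphalf k].

(* At most two colors have odd multiplicity; appending the list formed by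
   these two colors makes every multiplicity even. *)
Lemma path_proportional w : exists f, proportional w f.
Proof.
have [p [q [op pq oq]]] := other_colors ord0.
have po : p != ord0 by rewrite eq_sym.
have qp : q != p by rewrite eq_sym.
have qo : q != ord0 by rewrite eq_sym.
(* Each list contributes two to this sum, so either none or exactly two multiplicities are odd. *)
have sum : ~~ odd (count (predC1 ord0) w + count (predC1 p) w + count (predC1 q) w).
  elim: w => //= x w; case: (color3 x op pq oq) => ->;
  rewrite ?eqxx ?(negPf op) ?(negPf pq) ?(negPf oq) ?(negPf po) ?(negPf qp) ?(negPf qo) /=; lia.
have : even_word w \/ exists t, even_word (rcons w t).
  have key t : (forall x, odd (count (predC1 x) w) = (t != x)) -> even_word (rcons w t).
    by move=> H x; rewrite -cats1 count_cat oddD H /= addn0; case: eqP.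
  have split3 (P : 'I_3 -> Prop) : P ord0 -> P p -> P q -> forall x, P x.
    by move=> P0 Pp Pq x; case: (color3 x op pq oq) => ->.
  have [o|o] := boolP (odd (count (predC1 ord0) w));
  have [op'|op'] := boolP (odd (count (predC1 p) w)); first last.
  - left; apply: split3 => //; lia.
  - right; exists ord0; apply: key; apply: split3; rewrite ?eqxx ?op ?oq; lia.
  - right; exists p; apply: key; apply: split3; rewrite ?eqxx ?po ?pq; lia.
  - right; exists q; apply: key; apply: split3; rewrite ?eqxx ?qo ?qp; lia.
case=> [/even_solvable[f [h1 h2 h3]]|[t /even_solvable[f [h1 h2 h3]]]].
  exists f; split=> // c; have := h3 c; move: (count_mem c f) (count _ w); clear.
  by move=> m k <- /=; lia.
case/lastP: f h1 h2 h3 => [|f y] h1 h2 h3.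
  by have := all2_size h1; rewrite size_rcons.
have sz : size f = size w by have := all2_size h1; rewrite !size_rcons => -[].
move: h1 h2; rewrite -!cats1 all2_cat // sorted_junction => /andP[h1 /andP[ty _]] /andP[h2 _].
exists f; split=> // c; have := h3 c; rewrite -!cats1 !count_cat /= !addn0.
(* The dropped color [y] comes from the appended list, hence has odd multiplicity in [w]. Its count
   is thereby rounded down, that of the other odd color is rounded up. *)
have : (y == c) <= (t != c) by case: eqP => // <-; rewrite [t != y]ty.
move: (y == c) (t != c) (count_mem c f) (count (predC1 c) w); clear.
by case=> -[] m k //= _; lia.
Qed.

(** * Paths are choosable *)

Lemma all2_nth (w f : seq 'I_3) x y i : all2 neq w f -> i < size w ->
  nth x w i != nth y f i.
Proof.
by elim: w f i => [|a w IH] [|b f] //= [|i] /andP[ab h] //=; apply: IH.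
Qed.

Lemma card_nth (T : finType) n (f : T -> 'I_n) (s : seq 'I_3) x P :
  bijective f -> size s = n -> #|[set v | P (nth x s (f v))]| = count P s.
Proof.
move=> bf sz; rewrite -sum1_card -sum1_count (big_nth x) sz big_mkord.
rewrite (reindex f) /=; last exact: onW_bij.
by apply: eq_bigl => v; rewrite inE.
Qed.

Lemma missing_color (L : {set 'I_3}) : #|L| = 2 -> exists m, forall x, (x \in L) = (x != m).
Proof.
move=> L2; have /eqP/cards1P[m E] : #|~: L| = 1 by have := cardsC L; rewrite L2 card_ord; lia.
by exists m => x; rewrite -in_set1 -E inE negbK.
Qed.

Lemma path_choosable (T : finType) (e : rel T) n :
  graph_iso e (@path_graph n) -> proportionally_choosable 2 3 e.
Proof.
move=> [f bf fe] L L2.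
have /fin_all_exists[miss missE] v := missing_color (L2 v).
have [g fK gK] := bf.
pose w := [seq miss (g i) | i <- enum 'I_n].
have wn : size w = n by rewrite size_map size_enum_ord.
have wE v : nth ord0 w (f v) = miss v.
  by rewrite (nth_map (f v)) ?size_enum_ord // nth_ord_enum fK.
have [s [ws ss cs]] := path_proportional w.
have sn : size s = n by rewrite (all2_size ws).
exists (fun v => nth ord0 s (f v)); split=> [v|u v|c _].
- rewrite missE -wE eq_sym; apply: all2_nth => //; by rewrite wn.
- rewrite -fe => /orP[]/eqP E /eqP; apply/negP.
    by rewrite -E; have /sortedP := ss; apply; rewrite E sn.
  by rewrite eq_sym -E; have /sortedP := ss; apply; rewrite E sn.
- have -> : multiplicity L c = count (predC1 c) w.
    rewrite -(card_nth ord0 _ bf wn) /multiplicity; congr #|pred_of_set _|.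
    by apply/setP => v; rewrite !inE missE /= wE eq_sym.
  rewrite (card_nth ord0 (pred1 c) bf sn) /ceil_divn; have := cs c.
  by rewrite /= dvdn2 negbK divn2 uphalf_half addnC.
Qed.

(** * Choosable graphs are paths *)

Section Necessity.
Variables (T : finType) (e : rel T).
Hypotheses (e_sym : symmetric e) (e_irr : irreflexive e).
Hypothesis chs : proportionally_choosable 2 3 e.

Let c0 : 'I_3 := @Ordinal 3 0 isT.
Let c1 : 'I_3 := @Ordinal 3 1 isT.
Let c2 : 'I_3 := @Ordinal 3 2 isT.

(** With the lists [{0, 1}] on [A] and [{0, 2}] elsewhere, [c1] and [c2] have multiplicities [#|A|]
    and [#|~: A|]. For an even multiplicity the two roundings of its half coincide. *)
Lemma choose_half (A : {set T}) : exists f : T -> 'I_3,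
  [/\ forall v, f v = c0 \/ f v = if v \in A then c1 else c2,
      forall u v, e u v -> f u <> f v,
      ~~ odd #|A| -> #|[set v | f v == c1]|.*2 = #|A|
    & ~~ odd #|~: A| -> #|[set v | f v == c2]|.*2 = #|~: A|].
Proof.
pose L v : {set 'I_3} := if v \in A then [set c0; c1] else [set c0; c2].
have [|f [fL fe fc]] := chs (L := L).
  by move=> v; rewrite /L; case: ifP; rewrite cards2.
have half c : ~~ odd (multiplicity L c) -> #|[set v | f v == c]|.*2 = multiplicity L c.
  move=> ev; have [/fc|cP] := boolP (c \in palette L).
    by rewrite /ceil_divn dvdn2 ev divn2 addn0; lia.
  have Lc v : (c \in L v) = false.
    by apply: contraNF cP => cv; apply/bigcupP; exists v.
  rewrite /multiplicity (eq_card0 (A := [set v | c \in L v])) => [|v]; last by rewrite !inE Lc.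
  by rewrite eq_card0 // => v; rewrite !inE; apply/negP => /eqP E; have := fL v; rewrite E Lc.
have LA1 : [set v | c1 \in L v] = A.
  by apply/setP => v; rewrite inE /L; case: ifP; rewrite !inE.
have LA2 : [set v | c2 \in L v] = ~: A.
  by apply/setP => v; rewrite !inE /L; case: ifP; rewrite !inE.
exists f; split=> //.
- by move=> v; have := fL v; rewrite /L; case: ifP => _; rewrite !inE => /orP[]/eqP; auto.
- by have := half c1; rewrite /multiplicity LA1.
- by have := half c2; rewrite /multiplicity LA2.
Qed.

Lemma no_claw v a b c : uniq [:: a; b; c] -> e v a -> e v b -> ~~ e v c.
Proof.
move=> un va vb; apply/negP => vc.
have vneq x : e v x -> v != x by apply: contraTneq => <-; rewrite e_irr.
have un4 : uniq [:: v; a; b; c].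
  by rewrite cons_uniq un andbT !inE !negb_or !vneq.
pose A := [set x in [:: v; a; b; c]].
have inA x : (x \in A) = (x == v) || (x \in [:: a; b; c]) by rewrite !inE.
have cardA : #|A| = 4 by rewrite cardsE; apply/card_uniqP.
have [f [fL fe + _]] := choose_half A; rewrite cardA => /(_ isT).
have fA x : x \in [:: a; b; c] -> (f x == c1) = (f v != c1).
  rewrite !inE => xabc.
  have xA : x \in A by rewrite !inE xabc orbT.
  have vA : v \in A by rewrite !inE eqxx.
  have vx : f v <> f x by apply: fe; case/or3P: xabc => /eqP->.
  by case: (fL x) (fL v) vx => ->; rewrite ?xA vA => -[] ->.
have fo x : x \notin A -> (f x == c1) = false.
  by move=> xA; case: (fL x) => ->; rewrite ?(negPf xA).
have [vc1|vc1] := boolP (f v == c1).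
  have -> : [set x | f x == c1] = [set v].
    apply/setP => x; rewrite !inE; have [->//|xv] := eqVneq x v.
    have [xA|/fo //] := boolP (x \in A).
    by rewrite fA ?vc1 //; move: xA; rewrite inA (negPf xv).
  by rewrite cards1.
have -> : [set x | f x == c1] = [set x in [:: a; b; c]].
  apply/setP => x; rewrite [LHS]inE [RHS]inE; have [xabc|] := boolP (x \in [:: a; b; c]).
    by rewrite fA.
  have [->|xv] := eqVneq x v; first by rewrite (negPf vc1) => /negPf.
  by move=> nx; rewrite fo ?(negPf nx) // inA negb_or xv.
by rewrite cardsE; have /card_uniqP-> := un.
Qed.

Lemma no_hamiltonian_cycle (p : nat -> T) n : 2 < n ->
    (forall v, exists2 i, i < n & v = p i) ->
    (forall i j, i < n -> j < n -> p i = p j -> i = j) ->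
    (forall i, i.+1 < n -> e (p i) (p i.+1)) ->
  ~~ e (p n.-1) (p 0).
Proof.
move=> n2 ps pinj adj; apply/negP => closing.
have [on|en] := boolP (odd n).
  (* All lists are [{0, 1}], so the colors alternate along the path and its two ends agree when [n]
     is odd. *)
  have [f [fL fe _ _]] := choose_half [set: T].
  have fi i : i < n -> (f (p i) == f (p 0)) = ~~ odd i.
    elim: i => [|i IH] lt; first by rewrite eqxx.
    have := IH (ltnW lt); have := fe _ _ (adj _ lt).
    move: (fL (p i)) (fL (p i.+1)) (fL (p 0)); rewrite !inE /=.
    by case: (odd i) => -[->|->] [->|->] [->|->].
  by apply: (fe _ _ closing); apply/eqP; rewrite fi; lia.
pose A := ~: [set p 0; p 2].
have p02 : p 0 != p 2 by apply/eqP => /pinj; lia.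
have cT : #|T| = n.
  pose g (i : 'I_n) := p i.
  rewrite -(card_ord n) -(card_codom (f := g)); last first.
    by move=> i j /pinj E; apply: val_inj; apply: E.
  apply/esym/eq_card => v; apply/codomP; have [i lt ->] := ps v.
  by exists (Ordinal lt).
have cAC : #|~: A| = 2 by rewrite setCK cards2 p02.
have cA : #|A| = n - 2 by have := cardsC A; lia.
have [f [fL fe]] := choose_half A.
rewrite cA cAC => /(_ _)/[dup] _ n1 /(_ isT) n2'.
have {}n1 : #|[set v | f v == c1]|.*2 = n - 2 by apply: n1; lia.
have inA i : i < n -> (p i \in A) = (i != 0) && (i != 2).
  move=> lt; rewrite !inE negb_or; congr (~~ _ && ~~ _); apply/eqP/eqP => [/pinj|->] //; apply; lia.
have step u v : e u v -> v \in A -> f u = c0 -> f v = c1.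
  by move=> /fe uv vA u0; case: (fL v) uv; rewrite u0 ?vA => ->.
have step' u v : e u v -> v \in A -> f u = c1 -> f v = c0.
  by move=> /fe uv vA u0; case: (fL v) uv; rewrite u0 ?vA => ->.
(* There are [n./2] odd positions, but by [n1] the color [c1] is used on only [n./2 - 1]
   vertices. *)
suff odds i : i < n -> odd i -> f (p i) = c1.
  pose g (i : 'I_(n./2)) := p i.*2.+1.
  have gi : injective g.
    move=> i j /pinj E; apply: val_inj; have := ltn_ord i; have := ltn_ord j.
    rewrite /=; move=> h1 h2; have := E; lia.
  have : #|[set g i | i in 'I_(n./2)]| <= #|[set v | f v == c1]|.
    apply: subset_leq_card; apply/subsetP => _ /imsetP[i _ ->]; rewrite inE.
    apply/eqP/odds; have := ltn_ord i; lia.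
  rewrite card_imset // cardT size_enum_ord; lia.
have /eqP/cards1P[x Ex] : #|[set v | f v == c2]| = 1 by lia.
have fx v : (f v == c2) = (v == x) by rewrite -in_set1 -Ex inE.
have xA : x \notin A.
  by apply/negP => xA; have := fx x; rewrite eqxx; case: (fL x) => ->; rewrite ?xA.
have /orP x02 : (x == p 0) || (x == p 2) by move: xA; rewrite !inE negbK.
have c0E v : v \notin A -> v != x -> f v = c0.
  by move=> vA vx; case: (fL v) => //; rewrite (negPf vA) => /eqP; rewrite fx (negPf vx).
case: x02 => /eqP xE.
(* Starting from [c0] at [p 2], the colors alternate back to [p 1] and forward to [p n.-1], through
   vertices of [A] only. *)
- have f2 : f (p 2) = c0 by apply: c0E; rewrite ?inA // xE eq_sym.
  have f1 : f (p 1) = c1.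
    by apply: step f2; rewrite ?inA //; [rewrite e_sym adj | lia].
  have fwd k : k.+2 < n -> f (p k.+2) = if odd k then c1 else c0.
    elim: k => [//|k IH] lt; have := IH (ltnW lt); rewrite /=.
    have Ak : p k.+3 \in A by rewrite inA.
    by case: (odd k) => /= fk; [apply: step' fk | apply: step fk]; rewrite ?adj.
  case: i => [|[|k]] // lt /=; rewrite negbK => ok.
  by rewrite fwd // ok.
(* Starting from [c0] at [p 0], they alternate forward to [p 1] and, across the closing edge, from
   [p n.-1] down to [p 3]. *)
- have f0 : f (p 0) = c0 by apply: c0E; rewrite ?inA ?xE // ; lia.
  have f1 : f (p 1) = c1.
    by apply: step f0; rewrite ?inA ?adj //; lia.
  have bwd k : k + 3 < n -> f (p (n.-1 - k)) = if odd k then c0 else c1.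
    elim: k => [|k IH] lt.
      by rewrite subn0 /=; apply: step f0; rewrite ?inA 1?e_sym //; lia.
    have := IH (ltnW lt); rewrite /=.
    have Ak : p (n.-1 - k.+1) \in A by rewrite inA; lia.
    have ek : e (p (n.-1 - k)) (p (n.-1 - k.+1)).
      have -> : n.-1 - k = (n.-1 - k.+1).+1 by lia.
      by rewrite e_sym adj //; lia.
    by case: (odd k) => /= fk; [apply: step fk | apply: step' fk].
  move=> lt oi; have [->//|i1] := eqVneq i 1.
  have -> : i = n.-1 - (n.-1 - i) by lia.
  rewrite bwd; last by lia.
  have -> // : odd (n.-1 - i) = false by lia.
Qed.

Lemma longest_path : 0 < #|T| -> exists s : seq T,
  [/\ 0 < size s, uniq s, sorted e s &
   forall s', uniq s' -> sorted e s' -> size s' <= size s].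
Proof.
move=> T0; pose P k := [exists s : k.-tuple T, uniq s && sorted e s].
have exP : exists k, P k by exists 0; apply/existsP; exists [tuple].
have bP k : P k -> k <= #|T|.
  by case/existsP => s /andP[/card_uniqP E _]; rewrite -(size_tuple s) -E max_card.
case: (ex_maxnP exP bP) => k /existsP[s /andP[us ss]] kmax.
have mx s' : uniq s' -> sorted e s' -> size s' <= size s.
  move=> us' ss'; rewrite size_tuple; apply: kmax; apply/existsP.
  by exists (in_tuple s'); rewrite us'.
exists s; split=> //; have /card_gt0P[x _] := T0.
exact: (mx [:: x]).
Qed.

(** A neighbor of an end of a longest path lies on the path by maximality. An inner vertex has its
    two path neighbors and, by [no_claw], no others. So the path is closed under adjacency and, by
    connectedness, contains every vertex. *)
Lemma choosable_path : 0 < #|T| -> connected_graph e ->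
  exists n : nat, 0 < n /\ graph_iso e (@path_graph n).
Proof.
move=> T0 conn; have [s [s0 us ss smax]] := longest_path T0.
have /card_gt0P[x0 _] := T0.
pose n := size s; pose p := nth x0 s.
have pinj i j : i < n -> j < n -> p i = p j -> i = j.
  by move=> li lj /eqP; rewrite nth_uniq // => /eqP.
have adj i : i.+1 < n -> e (p i) (p i.+1) by move=> lt; have /sortedP := ss; apply.
have ps i : i < n -> p i \in s by move=> lt; apply: mem_nth.
have hd v : e (p 0) v -> v \in s.
  move=> ev; apply: contraT => vs; have := smax (v :: s); rewrite /= vs us ltnn.
  apply=> //; move: ev ss; rewrite /p; case: (s) s0 => //= y t _.
  by rewrite e_sym => ->.
have tl v : e (p n.-1) v -> v \in s.
  move=> ev; apply: contraT => vs; have := smax (rcons s v).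
  rewrite rcons_uniq vs us size_rcons ltnn; apply=> //.
  move: ev ss; rewrite /p /n nth_last; case: (s) s0 => //= y t _.
  by rewrite rcons_path => -> ->.
have mid i v : 0 < i -> i.+1 < n -> e (p i) v -> v = p i.-1 \/ v = p i.+1.
  move=> i0 lt ev; have [->|v1] := eqVneq v (p i.-1); first by left.
  have [->|v2] := eqVneq v (p i.+1); first by right.
  have un : uniq [:: p i.-1; p i.+1; v].
    rewrite /= !inE negb_or andbT [p i.-1 == v]eq_sym v1 [p i.+1 == v]eq_sym v2 !andbT.
    by apply/eqP => E; have := pinj i.-1 i.+1 _ _ E; lia.
  have e1 : e (p i) (p i.-1).
    have Ei : i = i.-1.+1 by lia.
    by rewrite e_sym {2}Ei adj -?Ei // ltnW.
  by have := no_claw un e1 (adj i lt); rewrite ev.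
have cl : closed e (mem s).
  apply: (intro_closed (sym_connect_sym e_sym)) => u v uv us'.
  have lt : index u s < n by rewrite index_mem.
  have uE : p (index u s) = u by apply: nth_index.
  have [i0|i0] := posnP (index u s); first by apply: hd; rewrite -i0 uE.
  have [i1|i1] := ltnP (index u s).+1 n; last first.
    have En : n.-1 = index u s by lia.
    by apply: tl; rewrite En uE.
  by case: (mid (index u s) v) => //; rewrite ?uE // => ->; apply: ps; lia.
have all_s v : v \in s.
  by have := closed_connect cl (conn (p 0) v) => /= <-; apply: ps.
have pidx v : p (index v s) = v by apply: nth_index.
have ilt v : index v s < n by rewrite index_mem.
have nocyc : 2 < n -> ~~ e (p n.-1) (p 0).
  by move=> n2; apply: no_hamiltonian_cycle => // v; exists (index v s); rewrite ?pidx.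
(* An edge at an inner vertex is a path edge by [mid]; what remains is an edge joining the two ends,
   which [nocyc] excludes for [2 < n]. *)
have lt_adj i j : i < j -> j < n -> e (p i) (p j) -> j = i.+1.
  move=> ij jn eij; case: (posnP i) => [i0|i0]; last first.
    have i1 : i.+1 < n by lia.
    by case: (mid i (p j) i0 i1 eij) => E; [have := pinj j i.-1 jn _ E | have := pinj j i.+1 jn i1 E]; lia.
  subst i; have [j1|j1] := ltnP j.+1 n.
    by rewrite e_sym in eij; case: (mid j (p 0) ij j1 eij) => E; [have := pinj 0 j.-1 _ _ E | have := pinj 0 j.+1 _ j1 E]; lia.
  have [//|j2] := eqVneq j 1.
  have Ej : j = n.-1 by lia.
  by have /negP[] := nocyc ltac:(lia); rewrite e_sym -Ej.
exists n; split=> //; exists (fun v => Ordinal (ilt v)).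
  exists (fun i : 'I_n => p i) => [v|i]; first exact: pidx.
  by apply: val_inj; rewrite /= index_uniq.
move=> x y; have -> : e x y = e (p (index x s)) (p (index y s)) by rewrite !pidx.
rewrite /path_graph /=.
have := ilt x; have := ilt y; move: (index x s) (index y s) => i j jn iN.
apply/idP/idP => [/orP[]/eqP E|eij].
- by rewrite -E adj // E.
- by rewrite e_sym -E adj // E.
- case: (ltngtP i j) => ij.
  + by rewrite (lt_adj i j) // eqxx.
  + by rewrite (lt_adj j i) ?eqxx ?orbT // e_sym.
  + by move: eij; rewrite ij e_irr.
Qed.
End Necessity.

Theorem theorem13 (T : finType) (e : rel T) (e_sym : symmetric e)
    (e_irr : irreflexive e) (T_nonempty : 0 < #|T|)
    (e_conn : connected_graph e) :
  proportionally_choosable 2 3 e <->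
  exists n : nat, 0 < n /\ graph_iso e (@path_graph n).
Proof.
split=> [chs|[n [_ iso]]]; last exact: path_choosable iso.
exact: choosable_path.
Qed.
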